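(* For $s-q\ge 1$, the complementary $\Gamma$-bound and the spectral bound for the Data-Fusion problem satisfy $\mathfrak{z}_{\text{c-}\Gamma}\le\mathfrak{z}_{\mathcal{S}}$.
   Context: Let $G\in\mathbb{R}^{p\times m}$, $H\in\mathbb{R}^{q\times m}$, $B:=H^\top H$ positive definite, $P:=\{1,\dots,p\}$, and $s$ an integer with $0<s-q<p$. The Data-Fusion problem is $\max\{\operatorname{ldet}(B+G^\top\operatorname{Diag}(x)G):\mathbf{e}^\top x=s-q,\ x\in\{0,1\}^p\}$, where $\operatorname{ldet}$ is log-determinant, $\mathbf{e}$ the all-ones vector, $\operatorname{Diag}(x)$ the diagonal matrix with diagonal $x$. $\lambda_i(X)$ denotes the $i$-th largest eigenvalue of a symmetric matrix $X$. The $\Gamma$-function: for $\lambda\in\mathbb{R}_+^k$ with $\lambda_1\ge\dots\ge\lambda_k$ and an integer $t$ with $0<t\le k$, there is a unique integer $\iota$ with $0\le\iota<t$ such that $\lambda_\iota>\frac{1}{t-\iota}\sum_{\ell=\iota+1}^k\lambda_\ell\ge\lambda_{\iota+1}$, with the convention $\lambda_0=+\infty$. Define $\phi_t(\lambda):=\sum_{\ell=1}^{\iota}\log(\lambda_\ell)+(t-\iota)\log\big(\frac{1}{t-\iota}\sum_{\ell=\iota+1}^k\lambda_\ell\big)$, with $\log(0)=-\infty$. For a symmetric positive-semidefinite $k\times k$ matrix $X$, $\Gamma_t(X):=\phi_t(\lambda(X))$, where $\lambda(X)$ is the vector of eigenvalues of $X$ in nonincreasing order. Complementary $\Gamma$-bound: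 let $\Phi\Phi^\top$ be the Cholesky factorization of the positive-definite matrix $I_p-G(B+G^\top G)^{-1}G^\top$, and let $\phi_i^\top$ be the $i$-th row of $\Phi$, $i\in P$. Then $$\mathfrak{z}_{\text{c-}\Gamma}:=\operatorname{ldet}(B+G^\top G)+\max\Big\{\Gamma_{p-(s-q)}\Big(\sum_{i\in P}z_i\phi_i\phi_i^\top\Big):\mathbf{e}^\top z=p-(s-q),\ 0\le z_i\le1\ (i\in P)\Big\}.$$ Spectral bound: $\mathfrak{z}_{\mathcal{S}}:=\operatorname{ldet}(B)+\sum_{i=1}^{s-q}\log\big(1+\lambda_i(GB^{-1}G^\top)\big)$. *)

(* Defs.v *)
From mathcomp Require Import all_boot all_order all_algebra.
From mathcomp Require Import all_classical all_reals all_analysis.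
From mathcomp Require Import sesquilinear spectral complex lra.

Set Implicit Arguments.
Unset Strict Implicit.
Unset Printing Implicit Defensive.
Import Order.TTheory GRing.Theory Num.Theory.
Local Open Scope classical_set_scope.
Local Open Scope ring_scope.

Definition posdefmx (R : realType) n (A : 'M[R]_n) : Prop :=
  A^T = A /\ forall v : 'cV[R]_n, v != 0 -> 0 < (v^T *m A *m v) 0 0.

Definition ldet (R : realType) n (A : 'M[R]_n) : R := ln (\det A).

(* The eigenvalues of X, repeated according to multiplicity, in nonincreasing
   order.  The sequence is unique when it exists, and it exists for every
   symmetric X (eigvals_sym); [::] is a junk value for other matrices.
   Indices are 0-based: (eigvals X)`_i is the (i+1)-st largest eigenvalue. *)
Definition eigvals (R : realType) n (X : 'M[R]_n) : seq R :=
  xget [::] [set l : seq R | sorted >=%R l /\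
                             char_poly X = \prod_(a <- l) ('X - a%:P)].

Lemma eigvals_sym (R : realType) n (X : 'M[R]_n) : X^T = X ->
  [/\ sorted >=%R (eigvals X), size (eigvals X) = n &
      char_poly X = \prod_(a <- eigvals X) ('X - a%:P)].
Proof.
move=> Xsym.
suff : exists l : seq R, sorted >=%R l /\
                         char_poly X = \prod_(a <- l) ('X - a%:P).
  move=> exl; rewrite /eigvals; case: xgetP => [l0 _ [sl El]|nol]; last first.
    by case: exl => l Hl; case: (nol l).
  split=> //.
  have := size_char_poly X; rewrite El size_prod_XsubC.
  by case.
pose C := complex R.
pose f : R -> C := real_complex R.
pose A : 'M[C]_n := map_mx f X.
have Aherm : A \is hermsymmx.
  apply: realsym_hermsym.
    apply/is_hermitianmxP; rewrite expr0 scale1r map_mx_id//.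
    by apply/matrixP => i j; rewrite !mxE -[in LHS]Xsym mxE.
  by apply/mxOverP => i j; rewrite mxE; apply/complex_realP; exists (X i j).
have Anorm := hermitian_normalmx Aherm.
have dreal := hermitian_spectral_diag_real Aherm.
set d := spectral_diag A in dreal.
have charA : char_poly A = \prod_(i < n) ('X - (d 0 i)%:P).
  have /orthomx_spectralP AE := Anorm.
  have Pu : spectralmx A \in unitmx by exact: spectral_unit.
  have conj (P D : 'M[C]_n) : P \in unitmx ->
      char_poly (invmx P *m D *m P) = char_poly D.
    move=> PU; rewrite /char_poly /char_poly_mx !map_mxM /=.
    set P' := map_mx polyC P; set Q := map_mx polyC (invmx P).
    have QP : Q *m P' = 1%:M by rewrite -map_mxM mulVmx// map_mx1.
    have {1}-> : 'X%:M = Q *m 'X%:M *m P' by rewrite scalar_mxC -mulmxA QP mulmx1.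
    by rewrite -mulmxBl -mulmxBr !det_mulmx mulrAC -det_mulmx QP det1 mul1r.
  rewrite AE conj// -/d.
  rewrite char_poly_trig ?diag_mx_is_trig//.
  by apply: eq_bigr => i _; rewrite mxE eqxx mulr1n.
pose l : seq R := [seq complex.Re (d 0 i) | i <- index_enum 'I_n].
have El : char_poly X = \prod_(a <- l) ('X - a%:P).
  apply: (@map_poly_inj _ _ (real_complex R)); rewrite map_char_poly -/A charA.
  rewrite rmorph_prod /= /l big_map; apply: eq_bigr => i _.
  rewrite rmorphB /= map_polyX map_polyC /=; congr (_ - _%:P).
  by have /mxOverP/(_ 0 i)/complex_realP[r ->] := dreal.
exists (sort >=%R l); split; first by apply: sort_sorted; exact: ge_total.
rewrite El; apply: perm_big.
by rewrite perm_sym perm_sort.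
Qed.

(* (1 / (t - i)) * (lambda_{i+1} + ... + lambda_k), k being the size of lam. *)
Definition tailmean (R : realType) (t : nat) (lam : seq R) (i : nat) : R :=
  (t - i)%:R^-1 * \sum_(i <= l < size lam) lam`_l.

(* lambda_i > tailmean >= lambda_{i+1}; the disjunct i == 0 stands for the
   convention lambda_0 = +oo. *)
Definition iota_cond (R : realType) (t : nat) (lam : seq R) (i : nat) : bool :=
  ((i == 0%N) || (tailmean t lam i < lam`_i.-1)) && (lam`_i <= tailmean t lam i).

(* The unique i < t satisfying iota_cond (see iota_idx_uniq). *)
Definition iota_idx (R : realType) (t : nat) (lam : seq R) : nat :=
  find (iota_cond t lam) (iota 0 t).

Lemma tailmeanS (R : realType) (t : nat) (lam : seq R) (i : nat) :
  (i.+1 < t)%N -> (t <= size lam)%N ->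
  (t - i.+1)%:R * (tailmean t lam i.+1 - lam`_i) =
  (t - i)%:R * (tailmean t lam i - lam`_i) :> R.
Proof.
move=> it tk; have ik : (i < size lam)%N by rewrite (leq_trans _ tk)// ltnW.
rewrite !mulrBr /tailmean !mulrA !divff ?pnatr_eq0 ?subn_eq0 -?ltnNge ?(ltnW it)//.
by rewrite !mul1r (big_ltn ik) -[(t - i)%N]prednK ?subn_gt0 1?ltnW// -subnS; lra.
Qed.

Lemma iota_idx_uniq (R : realType) (t : nat) (lam : seq R) :
  sorted >=%R lam -> (forall a, a \in lam -> 0 <= a) ->
  (0 < t)%N -> (t <= size lam)%N ->
  [/\ (iota_idx t lam < t)%N, iota_cond t lam (iota_idx t lam) &
      forall i, (i < t)%N -> iota_cond t lam i -> i = iota_idx t lam].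
Proof.
move=> lamS lam0 t0 tk.
have lam_ge0 j : 0 <= lam`_j.
  by have [jk|jk] := ltnP j (size lam); [exact/lam0/mem_nth|rewrite nth_default].
have lamD j : lam`_j.+1 <= lam`_j.
  have [jk|jk] := ltnP j.+1 (size lam); last by rewrite (nth_default _ jk).
  exact: (sortedP 0 lamS).
have lt_step i : (i.+1 < t)%N ->
    (tailmean t lam i.+1 < lam`_i) = (tailmean t lam i < lam`_i).
  move=> it; have E := tailmeanS it tk.
  have p1 : 0 < (t - i.+1)%:R :> R by rewrite ltr0n subn_gt0.
  have p2 : 0 < (t - i)%:R :> R by rewrite ltr0n subn_gt0 ltnW.
  by rewrite -subr_lt0 -(pmulr_rlt0 _ p1) E pmulr_rlt0// subr_lt0.
have ex_le : exists i, (i < t)%N && (lam`_i <= tailmean t lam i).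
  exists t.-1; rewrite prednK// leqnn /= /tailmean.
  rewrite big_ltn ?prednK// -subn1 subKn// invr1 mul1r lerDl.
  by apply: sumr_ge0 => j _.
have ex_iota : exists2 i, (i < t)%N & iota_cond t lam i.
  case: (ex_minnP ex_le) => i /andP[it le_i] imin; exists i => //.
  rewrite /iota_cond le_i andbT; case: i it le_i imin => [//|i] it _ imin /=.
  rewrite lt_step// ltNge; apply/negP => le_i.
  by have := imin i; rewrite le_i (ltnW it) ltnn => /(_ isT).
have le_mono i j : (i <= j)%N -> (j < t)%N -> lam`_i <= tailmean t lam i ->
    lam`_j <= tailmean t lam j.
  move=> + + le_i; elim: j => [|j IH]; first by rewrite leqn0 => /eqP <-.
  rewrite leq_eqVlt => /predU1P[<-//|]; rewrite ltnS => ij jt.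
  apply: le_trans (lamD j) _; rewrite leNgt lt_step// -leNgt.
  by apply: IH => //; exact: ltnW.
have no_lt i j : (i < j)%N -> (j < t)%N -> iota_cond t lam i ->
    ~ iota_cond t lam j.
  case: j => // j; rewrite ltnS => ij jt /andP[_ le_i] /andP[/= lt_j _].
  move: lt_j; rewrite lt_step// ltNge (le_mono i j)//; exact: ltnW.
have hasc : has (iota_cond t lam) (iota 0 t).
  by case: ex_iota => i it ci; apply/hasP; exists i; rewrite ?mem_iota.
have idx_lt : (iota_idx t lam < t)%N.
  by move: hasc; rewrite has_find size_iota.
have idx_c : iota_cond t lam (iota_idx t lam).
  by have := nth_find 0 hasc; rewrite nth_iota.
split=> // i it ci; case: (ltngtP i (iota_idx t lam)) => // h.
- by case: (no_lt _ _ h idx_lt ci).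
- by case: (no_lt _ _ h it idx_c).
Qed.

(* Extended-real valued because of log 0 = -oo (lne 0 = -oo). *)
Definition phi (R : realType) (t : nat) (lam : seq R) : \bar R :=
  let i := iota_idx t lam in
  (\sum_(0 <= l < i) lne (lam`_l)%:E +
   (t - i)%:R%:E * lne (tailmean t lam i)%:E)%E.

Definition Gamma (R : realType) (t : nat) n (X : 'M[R]_n) : \bar R :=
  phi t (eigvals X).

Definition is_cholesky (R : realType) n (A Phi : 'M[R]_n) : Prop :=
  [/\ is_trig_mx Phi, (forall i, 0 < Phi i i) & Phi *m Phi^T = A].

Definition Bmx (R : realType) q m (H : 'M[R]_(q, m)) : 'M[R]_m := H^T *m H.

Definition compl_mx (R : realType) p q m (G : 'M[R]_(p, m)) (H : 'M[R]_(q, m)) :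
    'M[R]_p :=
  1%:M - G *m invmx (Bmx H + G^T *m G) *m G^T.

(* sum_i z_i phi_i phi_i^T, where the column vector phi_i is (row i Phi)^T. *)
Definition Mz (R : realType) p (Phi : 'M[R]_p) (z : 'cV[R]_p) : 'M[R]_p :=
  \sum_(i < p) z i 0 *: ((row i Phi)^T *m row i Phi).

Definition relaxed (R : realType) p (t : nat) : set 'cV[R]_p :=
  [set z | \sum_(i < p) z i 0 = t%:R /\ forall i, 0 <= z i 0 <= 1].

(* The maximum is rendered as the supremum in the extended reals. *)
Definition cGamma_bound (R : realType) p q m (G : 'M[R]_(p, m))
    (H : 'M[R]_(q, m)) (s : nat) (Phi : 'M[R]_p) : \bar R :=
  ((ldet (Bmx H + G^T *m G))%:E +
   ereal_sup [set Gamma (p - (s - q)) (Mz Phi z) |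
              z in @relaxed R p (p - (s - q))])%E.

Definition spectral_bound (R : realType) p q m (G : 'M[R]_(p, m))
    (H : 'M[R]_(q, m)) (s : nat) : R :=
  ldet (Bmx H) +
  \sum_(i < s - q) ln (1 + (eigvals (G *m invmx (Bmx H) *m G^T))`_i).

(* Main.v *)
(** Write mu for the eigenvalues of K = G B^-1 G^T.  By Woodbury,
    Phi Phi^T = (1 + K)^-1, so Y = (Phi^T Phi)^-1 has eigenvalues 1 + mu_j, and
    the matrix M = sum_i z_i phi_i phi_i^T satisfies tr (M Y) = sum_i z_i = t,
    where t = p - (s - q).  Let lambda be the eigenvalues of M and tau the tail
    mean in the definition of phi_t.  With v_i = min (1, lambda_i / tau) and
    y_i = max (lambda_i, tau) one has v_i y_i = lambda_i, sum_i v_i = t and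
    phi_t lambda = sum_i v_i ln y_i.  The squared moduli S_ij of the transition
    matrix between eigenbases of M and Y form a doubly stochastic matrix with
    sum_ij lambda_i S_ij (1 + mu_j) = t.  Averaging
    ln (y_i (1 + mu_j)) <= y_i (1 + mu_j) - 1 with the weights v_i S_ij thus
    gives phi_t lambda <= - sum_j w_j ln (1 + mu_j), where w_j = sum_i v_i S_ij
    lies in [0, 1] and sum_j w_j = t.  The right-hand side is largest when w
    selects the t smallest mu_j, and Sylvester's identity
    det (B + G^T G) = det B * prod_j (1 + mu_j) finishes the proof. *)

Require Import Defs.
From mathcomp Require Import all_boot all_order all_algebra.
From mathcomp Require Import all_classical all_reals all_analysis.
From mathcomp Require Import perm sesquilinear spectral complex ring lra.

Set Implicit Arguments.
Unset Strict Implicit.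
Unset Printing Implicit Defensive.
Import Order.TTheory GRing.Theory Num.Theory.
Local Open Scope ring_scope.

(** * Characteristic polynomials, their roots and determinants *)

Lemma char_poly_conj (F : fieldType) n (P A : 'M[F]_n) : P \in unitmx ->
  char_poly (invmx P *m A *m P) = char_poly A.
Proof.
move=> Pu; rewrite /char_poly /char_poly_mx !map_mxM /=.
set P' := map_mx polyC P; set Q := map_mx polyC (invmx P).
have QP : Q *m P' = 1%:M by rewrite -map_mxM mulVmx// map_mx1.
have {1}-> : 'X%:M = Q *m 'X%:M *m P'.
  by rewrite scalar_mxC -mulmxA QP mulmx1.
by rewrite -mulmxBl -mulmxBr !det_mulmx mulrAC -det_mulmx QP det1 mul1r.
Qed.

Lemma char_poly_addr1 (F : fieldType) n (A : 'M[F]_n) (l : seq F) :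
  char_poly A = \prod_(a <- l) ('X - a%:P) ->
  char_poly (1%:M + A) = \prod_(a <- l) ('X - (1 + a)%:P).
Proof.
(* Substituting X - 1 for X is a ring morphism, so it commutes with the determinant. *)
move=> Al; have -> : char_poly (1%:M + A) = char_poly A \Po ('X - 1%:P).
  rewrite /char_poly -[RHS]/(comp_poly _ _) -det_map_mx; congr (\det _).
  apply/matrixP => i j; rewrite !mxE /= rmorphB rmorphMn /=.
  rewrite comp_polyX comp_polyC.
  by rewrite polyCD mulrnBl opprD addrA; case: (i == j); rewrite ?mulr1n ?mulr0n.
rewrite Al rmorph_prod; apply: eq_bigr => a _ /=.
by rewrite rmorphB /= comp_polyX comp_polyC polyCD opprD addrA.
Qed.

Lemma det_prod_root (F : fieldType) n (A : 'M[F]_n) (l : seq F) :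
  char_poly A = \prod_(a <- l) ('X - a%:P) -> \det A = \prod_(a <- l) a.
Proof.
move=> Al; have szl : size l = n.
  by have := size_char_poly A; rewrite Al size_prod_XsubC; case.
have := char_poly_det A; rewrite Al -horner_coef0 horner_prod.
under eq_bigr do rewrite hornerXsubC sub0r -mulN1r.
rewrite big_split /= big_const_seq count_predT iter_mulr_1 szl.
by move/mulfI => ->//; rewrite signr_eq0.
Qed.

(** The spectral theorem lists eigenvalues in an order of its own; this relates that order to a
    prescribed enumeration. *)
Lemma prod_XsubC_perm (F : fieldType) n (d z : 'I_n -> F) :
  \prod_i ('X - (d i)%:P) = \prod_i ('X - (z i)%:P) ->
  exists s : 'S_n, forall i, d i = z (s i).
Proof.
move=> E.
have /tuple_permP[s sE] : perm_eq [tuple d i | i < n] [tuple z i | i < n].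
  apply: prod_XsubC_eq; rewrite !big_tuple.
  under eq_bigr do rewrite tnth_mktuple.
  by under [RHS]eq_bigr do rewrite tnth_mktuple.
exists s => i; have /(congr1 (fun t => tnth t i)) := val_inj sE.
by rewrite !tnth_mktuple.
Qed.

(** * Unitary diagonalization and the doubly stochastic coupling of two spectra *)

Lemma unitarymx_row_normC (C : numClosedFieldType) n (U : 'M[C]_n) i :
  U \is unitarymx -> \sum_j `|U i j| ^+ 2 = 1.
Proof.
move=> /unitarymxP/matrixP/(_ i i); rewrite !mxE eqxx mulr1n => <-.
by apply: eq_bigr => j _; rewrite !mxE normCK.
Qed.

Lemma unitarymx_col_normC (C : numClosedFieldType) n (U : 'M[C]_n) j :
  U \is unitarymx -> \sum_i `|U i j| ^+ 2 = 1.
Proof.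
rewrite -trmxC_unitary => /(unitarymx_row_normC j) <-.
by apply: eq_bigr => i _; rewrite !mxE norm_conjC.
Qed.

(** By cyclicity the trace only sees the transition matrix U = P Q^-1: it equals the trace of D U E
    U^-1, and U^-1 is the conjugate transpose of U. *)
Lemma mxtrace_mul_unitary_diag (C : numClosedFieldType) n (P Q : 'M[C]_n)
    (d e : 'rV[C]_n) : P \is unitarymx -> Q \is unitarymx ->
  \tr (invmx P *m diag_mx d *m P *m (invmx Q *m diag_mx e *m Q)) =
  \sum_i \sum_j d 0 i * `|(P *m invmx Q) i j| ^+ 2 * e 0 j.
Proof.
move=> Pu Qu; have [Pun Qun] := (unitarymx_unit Pu, unitarymx_unit Qu).
set U := P *m invmx Q.
have Uu : U \is unitarymx.
  by rewrite /U mul_unitarymx// invmx_unitary// trmxC_unitary.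
have UV : U *m (Q *m invmx P) = 1%:M by rewrite /U mulmxA mulmxKV// mulmxV.
have Vu : (U ^t*)%sesqui = Q *m invmx P.
  rewrite -invmx_unitary// -[RHS]mul1mx -(mulVmx (unitarymx_unit Uu)).
  by rewrite -mulmxA UV mulmx1.
have -> : \tr (invmx P *m diag_mx d *m P *m (invmx Q *m diag_mx e *m Q)) =
          \tr (diag_mx d *m U *m (diag_mx e *m (U ^t*)%sesqui)).
  by rewrite Vu /U -!mulmxA mxtrace_mulC !mulmxA.
rewrite !mul_diag_mx; apply: eq_bigr => i _.
rewrite mxE; apply: eq_bigr => j _.
rewrite normCK !mxE. ring.
Qed.

(* [C] plays the role of [R[i]], [f] the embedding of the reals and [re] the real
   part; they are kept abstract since unification between the algebraic
   structures of the concrete [R[i]] is prohibitively slow. *)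
Section ComplexDiagonalization.
Variables (R : realFieldType) (C : numClosedFieldType).
Variables (f : {rmorphism R -> C}) (re : C -> R).
Hypothesis f_ge0 : forall r, (0 <= f r) = (0 <= r).
Hypothesis reK : {in Num.real, cancel re f}.

Lemma real_embedding_real r : f r \is Num.real.
Proof. by rewrite realE -[f r <= 0]oppr_ge0 -rmorphN !f_ge0 oppr_ge0 le_total. Qed.

Lemma sym_unitary_diag n (Z : 'M[R]_n) (z : 'I_n -> R) :
  Z^T = Z -> char_poly Z = \prod_i ('X - (z i)%:P) ->
  exists (P : 'M[C]_n) (s : 'S_n), P \is unitarymx /\
    map_mx f Z = invmx P *m diag_mx (\row_i f (z (s i))) *m P.
Proof.
move=> Zsym chZ.
have Aherm : map_mx f Z \is hermsymmx.
  apply: realsym_hermsym.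
    apply/is_hermitianmxP; rewrite expr0 scale1r map_mx_id//.
    by apply/matrixP => i j; rewrite !mxE -[in LHS]Zsym mxE.
  by apply/mxOverP => i j; rewrite mxE; exact: real_embedding_real.
have /orthomx_spectralP AD := hermitian_normalmx Aherm.
have chd : char_poly (map_mx f Z) =
    \prod_i ('X - (spectral_diag (map_mx f Z) 0 i)%:P).
  rewrite [in LHS]AD char_poly_conj ?spectral_unit// char_poly_trig.
    by apply: eq_bigr => i _; rewrite mxE eqxx mulr1n.
  exact: diag_mx_is_trig.
have chz : char_poly (map_mx f Z) = \prod_i ('X - (f (z i))%:P).
  rewrite -map_char_poly chZ rmorph_prod /=; apply: eq_bigr => i _.
  by rewrite rmorphB /= map_polyX map_polyC.
have [s dE] := prod_XsubC_perm (etrans (esym chd) chz).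
exists (spectralmx (map_mx f Z)), s; split; first exact: spectral_unitarymx.
rewrite [LHS]AD; congr (_ *m diag_mx _ *m _).
by apply/rowP => i; rewrite mxE dE.
Qed.

Lemma mxtrace_mul_doubly_stochastic n (X Y : 'M[R]_n) (x y : 'I_n -> R) :
  X^T = X -> Y^T = Y ->
  char_poly X = \prod_i ('X - (x i)%:P) ->
  char_poly Y = \prod_i ('X - (y i)%:P) ->
  exists S : 'I_n -> 'I_n -> R,
    [/\ forall i j, 0 <= S i j, forall i, \sum_j S i j = 1,
        forall j, \sum_i S i j = 1 &
        \tr (X *m Y) = \sum_i \sum_j x i * S i j * y j].
Proof.
move=> Xsym Ysym chX chY.
have [P [s [Pu XE]]] := sym_unitary_diag Xsym chX.
have [Q [u [Qu YE]]] := sym_unitary_diag Ysym chY.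
have Uu : P *m invmx Q \is unitarymx.
  by rewrite mul_unitarymx// invmx_unitary// trmxC_unitary.
have := mxtrace_mul_unitary_diag
  (\row_i f (x (s i))) (\row_i f (y (u i))) Pu Qu.
rewrite -XE -YE -map_mxM trace_map_mx; set U := P *m invmx Q => trE.
pose g i j := re (`|U i j| ^+ 2).
have gE i j : f (g i j) = `|U i j| ^+ 2 by rewrite reK// rpredX// normr_real.
have grow i : \sum_j g i j = 1.
  apply: (fmorph_inj f); rewrite rmorph1 rmorph_sum -(unitarymx_row_normC i Uu).
  by apply: eq_bigr => j _; exact: gE.
have gcol j : \sum_i g i j = 1.
  apply: (fmorph_inj f); rewrite rmorph1 rmorph_sum -(unitarymx_col_normC j Uu).
  by apply: eq_bigr => i _; exact: gE.
(* The diagonalizations carry the eigenvalues in the orders [x \o s] and [y \o u]; the inverse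
   permutations restore the given enumerations. *)
exists (fun i j => g (s^-1 i)%g (u^-1 j)%g); split.
- by move=> i j; rewrite -f_ge0 gE exprn_ge0.
- move=> i; rewrite (reindex_inj (@perm_inj _ u)) -(grow (s^-1 i)%g).
  by apply: eq_bigr => j _; rewrite permK.
- move=> j; rewrite (reindex_inj (@perm_inj _ s)) -(gcol (u^-1 j)%g).
  by apply: eq_bigr => i _; rewrite permK.
apply: (fmorph_inj f); rewrite [LHS]trE.
rewrite [in RHS](reindex_inj (@perm_inj _ s)) rmorph_sum.
apply: eq_bigr => i _.
rewrite [in RHS](reindex_inj (@perm_inj _ u)) rmorph_sum.
apply: eq_bigr => j _.
rewrite [X in X * _ * _]mxE [X in _ * _ * X]mxE !rmorphM -gE.
by rewrite !permK.
Qed.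

End ComplexDiagonalization.

Lemma mxtrace_mul_spectral (R : realType) n (X Y : 'M[R]_n) (x y : 'I_n -> R) :
  X^T = X -> Y^T = Y ->
  char_poly X = \prod_i ('X - (x i)%:P) ->
  char_poly Y = \prod_i ('X - (y i)%:P) ->
  exists S : 'I_n -> 'I_n -> R,
    [/\ forall i j, 0 <= S i j, forall i, \sum_j S i j = 1,
        forall j, \sum_i S i j = 1 &
        \tr (X *m Y) = \sum_i \sum_j x i * S i j * y j].
Proof.
apply: (@mxtrace_mul_doubly_stochastic R R[i] (real_complex R) (@complex.Re R)).
  exact: ler0c.
by move=> z zR; exact: RRe_real.
Qed.

(** * Scalar inequalities for [phi] *)

Lemma weighted_sum_le_tail (R : realType) n t (g w : 'I_n -> R) :
  (0 < t)%N -> (t <= n)%N ->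
  (forall i j : 'I_n, (i <= j)%N -> g i <= g j) ->
  (forall j, 0 <= w j <= 1) -> \sum_j w j = t%:R ->
  \sum_j w j * g j <= \sum_(j < n | (n - t <= j)%N) g j.
Proof.
move=> t0 tn gm w01 wt.
have rn : (n - t < n)%N by rewrite ltn_subrL t0 (leq_trans t0).
pose k := Ordinal rn.
pose d (j : 'I_n) : R := (n - t <= j)%N%:R.
have dt : \sum_j d j = t%:R.
  rewrite -(big_mkord xpredT (fun j => (n - t <= j)%N%:R)).
  rewrite (big_cat_nat _ (ltnW rn)) //= big_nat big1 => [|j /andP[_ jr]].
    rewrite add0r (eq_big_nat _ _ (F2 := fun=> 1)) => [|j /andP[-> _]//].
    by rewrite sumr_const_nat subKn.
  by rewrite leqNgt jr.
rewrite [leRHS]big_mkcond -subr_ge0 -sumrB.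
(* Both [d] and [w] have total mass t, so every [g j] may be shifted by the threshold value [g k].
   The two factors then have the same sign: both are nonnegative from [k] on, both nonpositive
   before it. *)
have -> : \sum_(j < n) ((if (n - t <= j)%N then g j else 0) - w j * g j) =
          \sum_j (d j - w j) * (g j - g k).
  under [RHS]eq_bigr do rewrite mulrBr.
  rewrite [RHS]sumrB -mulr_suml [in X in _ - X]sumrB dt wt subrr mul0r subr0.
  apply: eq_bigr => j _.
  by rewrite /d; case: ifP => _; rewrite mulrBl ?mul1r ?mul0r.
apply: sumr_ge0 => j _; have /andP[w0 w1] := w01 j; rewrite /d.
have [kj|jk] := leqP (n - t) j; first by rewrite mulr_ge0// subr_ge0// gm.
by rewrite mulr_le0// subr_le0 ?gm// ltnW.
Qed.

Lemma phi_weights (R : realType) t (lam : seq R) :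
  sorted >=%R lam -> (forall a, a \in lam -> 0 <= a) ->
  (0 < t)%N -> (t <= size lam)%N ->
  phi t lam = -oo%E \/ exists v y : nat -> R,
    [/\ forall l, 0 <= v l <= 1, forall l, 0 < y l,
        forall l, v l * y l = lam`_l,
        \sum_(l < size lam) v l = t%:R &
        phi t lam = (\sum_(l < size lam) v l * ln (y l))%:E].
Proof.
move=> lamS lam0 t0 tk.
have [it /andP[c1 c2] _] := iota_idx_uniq lamS lam0 t0 tk.
rewrite /phi; set i := iota_idx t lam in it c1 c2 *.
set tau := tailmean t lam i in c1 c2 *.
have lam_ge0 j : 0 <= lam`_j.
  by have [jk|jk] := ltnP j (size lam); [exact/lam0/mem_nth|rewrite nth_default].
(* Past the end of the list [nth] returns 0, which keeps the sequence nonincreasing because the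
   entries are nonnegative. *)
have lamD : {homo (fun j => lam`_j) : j k / (j <= k)%N >-> (k <= j)%O}.
  apply/nonincreasing_seqP => j.
  have [jk|jk] := ltnP j.+1 (size lam); last by rewrite (nth_default _ jk).
  exact: (sortedP 0 lamS).
have ti0 : 0 < (t - i)%:R :> R by rewrite ltr0n subn_gt0.
have hd l : (l < i)%N -> tau < lam`_l.
  case: (i) c1 => // i' /= c1 li; exact: lt_le_trans c1 (lamD _ _ _).
have tau_ge0 : 0 <= tau.
  by rewrite mulr_ge0 ?invr_ge0 ?(ltW ti0)// sumr_ge0.
have hdE : (\sum_(0 <= l < i) lne (lam`_l)%:E =
            (\sum_(0 <= l < i) ln lam`_l)%:E)%E.
  rewrite -sumEFin; apply: eq_big_nat => l /andP[_ li].
  by rewrite lne_EFin// (le_lt_trans tau_ge0)// hd.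
(* When [tau] is 0, the positive coefficient t - i multiplies log 0 and forces [phi] to -oo;
   otherwise the quotients by [tau] make sense. *)
rewrite hdE; move: tau_ge0; rewrite le_eqVlt => /predU1P[tau0|tau_gt0].
  by left; rewrite -tau0 /= lexx gt0_muleNy ?lte_fin.
right; pose v l := if (l < i)%N then 1 else lam`_l / tau.
pose y l := if (l < i)%N then lam`_l else tau; exists v, y.
have ik : (i <= size lam)%N by rewrite ltnW// (leq_trans it).
have split_sum (F : nat -> R) : \sum_(l < size lam) F l =
    \sum_(0 <= l < i) F l + \sum_(i <= l < size lam) F l.
  by rewrite -(big_mkord xpredT F) (big_cat_nat _ ik).
have tl : \sum_(i <= l < size lam) lam`_l = (t - i)%:R * tau.
  by rewrite /tau /tailmean mulrA divff ?mul1r// gt_eqF.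
split.
- move=> l; rewrite /v; case: ltnP => [_|il]; first by rewrite ler01 lexx.
  rewrite divr_ge0 ?(ltW tau_gt0)//= ler_pdivrMr// mul1r.
  exact: le_trans (lamD _ _ il) c2.
- by move=> l; rewrite /y; case: ltnP => // /hd; exact: lt_trans.
- by move=> l; rewrite /v /y; case: ltnP => _; rewrite ?mul1r// divfK// gt_eqF.
- rewrite (split_sum v) /v.
  rewrite (eq_big_nat _ _ (F2 := fun=> 1)); last by move=> l /andP[_ ->].
  rewrite [X in _ + X](eq_big_nat _ _ (F2 := fun l => lam`_l / tau)); last first.
    by move=> l /andP[il _]; rewrite ltnNge il.
  rewrite -mulr_suml tl mulfK ?gt_eqF// sumr_const_nat subn0 -natrD subnKC//.
  exact: ltnW.
- rewrite (split_sum (fun l => v l * ln (y l))) /v /y lne_EFin//.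
  rewrite -EFinM -EFinD; congr (_ + _)%:E.
    by apply: eq_big_nat => l /andP[_ ->]; rewrite mul1r.
  rewrite [RHS](eq_big_nat _ _ (F2 := fun l => lam`_l / tau * ln tau)); last first.
    by move=> l /andP[il _]; rewrite ltnNge il.
  by rewrite -mulr_suml -mulr_suml tl mulfK// gt_eqF.
Qed.

Lemma phi_le_coupling (R : realType) n t (lam : seq R)
    (S : 'I_n -> 'I_n -> R) (c : 'I_n -> R) :
  sorted >=%R lam -> (forall a, a \in lam -> 0 <= a) -> size lam = n ->
  (0 < t)%N -> (t <= n)%N ->
  (forall i j, 0 <= S i j) -> (forall i, \sum_j S i j = 1) ->
  (forall j, \sum_i S i j = 1) ->
  (forall j, 0 < c j) -> (forall i j : 'I_n, (i <= j)%N -> c j <= c i) ->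
  \sum_(i < n) \sum_(j < n) lam`_i * S i j * c j = t%:R ->
  (phi t lam <= (- \sum_(j < n | (n - t <= j)%N) ln (c j))%:E)%E.
Proof.
move=> lamS lam0 szl t0 tn S0 Srow Scol c0 cD trE; subst n.
have [->|[v [y [v01 y0 vy vt ->]]]] := phi_weights lamS lam0 t0 tn.
  exact: leNye.
pose w j := \sum_(i < size lam) v i * S i j.
have wt : \sum_j w j = t%:R.
  rewrite exchange_big -vt; apply: eq_bigr => i _.
  by rewrite -mulr_sumr Srow mulr1.
have w01 j : 0 <= w j <= 1.
  have vle i : (0 <= v i) /\ (v i <= 1) by apply/andP.
  rewrite sumr_ge0 => [|i _]; last by rewrite mulr_ge0// (vle i).1.
  rewrite -(Scol j) ler_sum// => i _.
  by rewrite ler_piMl// (vle i).2.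
rewrite lee_fin -sumrN.
have gm (i j : 'I_(size lam)) : (i <= j)%N -> - ln (c i) <= - ln (c j).
  by move=> ij; rewrite lerN2 ler_ln ?posrE// cD.
apply: le_trans (weighted_sum_le_tail t0 tn gm w01 wt).
have -> : \sum_(l < size lam) v l * ln (y l) =
          \sum_(i < size lam) \sum_(j < size lam) v i * S i j * ln (y i).
  apply: eq_bigr => i _; rewrite -[in LHS](mulr1 (v i)) -(Srow i) mulr_sumr.
  by rewrite mulr_suml.
(* This is ln x <= x - 1 at x = [y i * c j]. *)
have lnle i j : ln (y i) <= y i * c j - 1 - ln (c j).
  have yc : 0 < y i * c j by rewrite mulr_gt0.
  have : ln (1 + (y i * c j - 1)) <= y i * c j - 1 by apply: le_ln1Dx; lra.
  by rewrite addrC subrK lnM ?posrE//; lra.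
have -> : \sum_j w j * - ln (c j) = \sum_(i < size lam) \sum_(j < size lam)
    v i * S i j * (y i * c j - 1 - ln (c j)).
  (* The first two double sums both equal t and cancel: the first by the trace hypothesis, the
     second because [w] has total mass t. *)
  have -> : \sum_j w j * - ln (c j) =
      \sum_(i < size lam) \sum_(j < size lam) lam`_i * S i j * c j -
      \sum_(i < size lam) \sum_(j < size lam) v i * S i j -
      \sum_(i < size lam) \sum_(j < size lam) v i * S i j * ln (c j).
    rewrite trE -[X in _ = _ - X - _]exchange_big wt subrr sub0r.
    rewrite [in RHS]exchange_big -sumrN; apply: eq_bigr => j _.
    by rewrite mulrN mulr_suml.
  rewrite -!sumrB; apply: eq_bigr => i _.
  rewrite -!sumrB; apply: eq_bigr => j _.
  rewrite -vy; ring.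
apply: ler_sum => i _; apply: ler_sum => j _; rewrite ler_wpM2l//.
by rewrite mulr_ge0//; case/andP: (v01 i).
Qed.

(** * Quadratic forms, positivity and determinants *)

Lemma root_char_poly_quadratic (R : realType) n (X : 'M[R]_n) (a : R) :
  root (char_poly X) a -> exists v : 'cV[R]_n,
    [/\ v != 0, 0 < (v^T *m v) 0 0 & (v^T *m X *m v) 0 0 = a * (v^T *m v) 0 0].
Proof.
rewrite -eigenvalue_root_char => /eigenvalueP[u uX u0].
exists u^T; rewrite trmxK; split.
- by apply: contra u0 => /eqP u0; rewrite -[u]trmxK u0 trmx0.
- rewrite mxE; under eq_bigr do rewrite mxE -expr2.
  have [j uj] : exists j, u 0 j != 0.
    apply/existsP; apply: contraNT u0; rewrite negb_exists => /forallP h.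
    by apply/eqP/rowP => j; rewrite mxE; apply/eqP; rewrite -[_ == _]negbK h.
  rewrite (bigD1 j)//= ltr_wpDr ?exprn_even_gt0//.
  by apply: sumr_ge0 => i _; exact: sqr_ge0.
- by rewrite uX -scalemxAl mxE.
Qed.

Lemma eigvals_ge0 (R : realType) n (X : 'M[R]_n) (a : R) : X^T = X ->
  (forall v : 'cV[R]_n, 0 <= (v^T *m X *m v) 0 0) -> a \in eigvals X -> 0 <= a.
Proof.
move=> Xsym Xpsd; have [_ _ chX] := eigvals_sym Xsym.
rewrite -root_prod_XsubC -chX => /root_char_poly_quadratic[v [_ vv va]].
by have := Xpsd v; rewrite va pmulr_lge0.
Qed.

Lemma posdefmx_det_gt0 (R : realType) n (X : 'M[R]_n) :
  posdefmx X -> 0 < \det X.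
Proof.
move=> [Xsym Xpos]; have [_ _ chX] := eigvals_sym Xsym.
rewrite (det_prod_root chX) big_seq prodr_gt0// => a.
rewrite -root_prod_XsubC -chX => /root_char_poly_quadratic[v [v0 vv va]].
by have := Xpos v v0; rewrite va pmulr_lgt0.
Qed.

Lemma posdefmx_unit (R : realType) n (X : 'M[R]_n) :
  posdefmx X -> X \in unitmx.
Proof. by move=> /posdefmx_det_gt0 dX; rewrite unitmxE unitfE gt_eqF. Qed.

Lemma gram_quadratic_ge0 (R : realType) m n (A : 'M[R]_(m, n)) (v : 'cV[R]_n) :
  0 <= (v^T *m (A^T *m A) *m v) 0 0.
Proof.
rewrite mulmxA -mulmxA -trmx_mul mxE sumr_ge0// => i _.
by rewrite mxE -expr2 sqr_ge0.
Qed.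

(** Sylvester's identity: one block matrix is factored into block triangular matrices in two ways,
    one for each Schur complement. *)
Lemma det_1DmulmxC (R : comNzRingType) m n
    (U : 'M[R]_(m, n)) (V : 'M[R]_(n, m)) :
  \det (1%:M + U *m V) = \det (1%:M + V *m U).
Proof.
have E1 : block_mx 1%:M (- U) V 1%:M =
    block_mx (1%:M + U *m V) (- U) 0 1%:M *m block_mx 1%:M 0 V 1%:M.
  rewrite mulmx_block ?(mulmx1, mul1mx, mul0mx, mulmx0) ?add0r.
  by rewrite mulNmx addrK.
have E2 : block_mx 1%:M (- U) V 1%:M =
    block_mx 1%:M 0 V 1%:M *m block_mx 1%:M (- U) 0 (1%:M + V *m U).
  rewrite mulmx_block ?(mulmx1, mul1mx, mul0mx, mulmx0) ?addr0.
  by rewrite mulmxN addrC addrK.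
have := congr1 determinant E1; rewrite {1}E2 !det_mulmx !det_ublock !det_lblock.
by rewrite !det1 !mul1r !mulr1.
Qed.

Lemma Mz_diag (R : realType) p (Phi : 'M[R]_p) (z : 'cV[R]_p) :
  Mz Phi z = Phi^T *m diag_mx z^T *m Phi.
Proof.
rewrite mul_mx_diag; apply/matrixP => i j; rewrite !mxE summxE.
apply: eq_bigr => k _.
by rewrite !mxE big_ord1 !mxE; ring.
Qed.

(** * The matrices of the Data-Fusion problem *)

Section DataFusion.
Variables (R : realType) (p q m : nat).
Variables (G : 'M[R]_(p, m)) (H : 'M[R]_(q, m)).
Hypothesis B_posdef : posdefmx (Bmx H).

Let B := Bmx H.
Let K := G *m invmx B *m G^T.

Let Bu : B \in unitmx. Proof. exact: posdefmx_unit. Qed.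

Lemma spectral_mx_sym : K^T = K.
Proof. by rewrite /K !trmx_mul trmxK trmx_inv B_posdef.1 mulmxA. Qed.

Lemma spectral_mx_quadratic_ge0 (v : 'cV[R]_p) : 0 <= (v^T *m K *m v) 0 0.
Proof.
(* As H^T H = B, the middle factor B^-1 H^T H B^-1 collapses to B^-1, which exhibits [K] as a Gram
   matrix. *)
have -> : K = (H *m invmx B *m G^T)^T *m (H *m invmx B *m G^T).
  rewrite !trmx_mul trmxK trmx_inv B_posdef.1 /K -!mulmxA; congr (_ *m (_ *m _)).
  by rewrite !mulmxA -/B -[H^T *m H]/B mulmxV// mul1mx.
exact: gram_quadratic_ge0.
Qed.

Lemma posdefmx_addG : posdefmx (B + G^T *m G).
Proof.
split=> [|v v0]; first by rewrite linearD /= B_posdef.1 trmx_mul trmxK.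
by rewrite mulmxDr mulmxDl mxE ltr_pwDl ?B_posdef.2// gram_quadratic_ge0.
Qed.

Lemma det_addG : \det (B + G^T *m G) = \det B * \det (1%:M + K).
Proof.
rewrite /K -mulmxA det_1DmulmxC -det_mulmx mulmxDr mulmx1.
by rewrite !mulmxA mulmxV// mul1mx.
Qed.

(** Woodbury's formula. With C = B + G^T G, replacing G^T G by C - B gives C^-1 (C - B) B^-1 = B^-1
    - C^-1, and the products telescope. *)
Lemma compl_mxK : compl_mx G H *m (1%:M + K) = 1%:M.
Proof.
rewrite /compl_mx -/B; have Cu := posdefmx_unit posdefmx_addG.
set C := B + _ in Cu *.
have E : G *m invmx C *m G^T *m K = K - G *m invmx C *m G^T.
  have -> : G *m invmx C *m G^T *m K =
            G *m invmx C *m (C - B) *m invmx B *m G^T.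
    by rewrite /C addrAC subrr add0r /K !mulmxA.
  by rewrite mulmxBr mulmxKV// mulmxBl mulmxK// mulmxBl.
by rewrite mulmxBl mul1mx mulmxDr mulmx1 E subrKC addrK.
Qed.

End DataFusion.

(** * Comparison of the two bounds *)

Theorem theorem15 (R : realType) (p q m s : nat)
    (G : 'M[R]_(p, m)) (H : 'M[R]_(q, m)) (Phi : 'M[R]_p)
    (B_posdef : posdefmx (Bmx H))
    (s_gt : (1 <= s - q)%N) (s_lt : (s - q < p)%N)
    (Phi_chol : is_cholesky (compl_mx G H) Phi) :
  (cGamma_bound G H s Phi <= (spectral_bound G H s)%:E)%E.
Proof.
have Ksym := spectral_mx_sym G B_posdef.
have Kge0 := spectral_mx_quadratic_ge0 G B_posdef.
have CK := compl_mxK G B_posdef; have detC := det_addG G B_posdef.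
rewrite /cGamma_bound /spectral_bound /ldet detC.
set K := G *m _ *m _ in Ksym Kge0 CK detC *.
have [muS szmu chK] := eigvals_sym Ksym.
have mu_ge0 j : 0 <= (eigvals K)`_j.
  have [jp|jp] := ltnP j (size (eigvals K)); last by rewrite nth_default.
  exact/(eigvals_ge0 Ksym Kge0)/mem_nth.
pose c (j : 'I_p) := 1 + (eigvals K)`_j.
have c_gt0 j : 0 < c j by rewrite ltr_wpDr.
have cD (i j : 'I_p) : (i <= j)%N -> c j <= c i.
  move=> ij; rewrite lerD2l; apply: (sorted_leq_nth ge_trans ge_refl) => //;
  by rewrite inE szmu.
have ch1K : char_poly (1%:M + K) = \prod_(j < p) ('X - (c j)%:P).
  by rewrite (char_poly_addr1 chK) (big_nth 0) szmu big_mkord.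
have det1K : \det (1%:M + K) = \prod_(j < p) c j.
  have := @det_prod_root _ _ (1%:M + K) [seq c j | j <- index_enum 'I_p].
  by rewrite !big_map; apply.
have t0 : (0 < p - (s - q))%N by rewrite subn_gt0.
have tp : (p - (s - q) <= p)%N by rewrite leq_subr.
have ptE : (p - (p - (s - q)) = s - q)%N by rewrite subKn// ltnW.
have [_ _ PhiC] := Phi_chol.
have PhiK : Phi *m (Phi^T *m (1%:M + K)) = 1%:M by rewrite mulmxA PhiC.
have [Phiu _] := mulmx1_unit PhiK.
have Phitu : Phi^T \in unitmx by rewrite unitmx_tr.
have KE : 1%:M + K = invmx Phi^T *m invmx Phi.
  by rewrite -[LHS](mulKmx Phitu) -[X in _ *m X](mulKmx Phiu) PhiK mulmx1.
(* This is (Phi^T Phi)^-1, written as a conjugate of 1 + K so that it visibly has the eigenvalues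
   [c j]. *)
pose Y := invmx Phi *m (1%:M + K) *m Phi.
have YE : Y = invmx Phi *m invmx Phi^T.
  by rewrite /Y KE -!mulmxA mulVmx// mulmx1.
have Ysym : Y^T = Y by rewrite YE trmx_mul !trmx_inv trmxK.
have chY : char_poly Y = \prod_(j < p) ('X - (c j)%:P).
  by rewrite /Y char_poly_conj.
have Gamma_le z : relaxed (p - (s - q)) z ->
    (Gamma (p - (s - q)) (Mz Phi z) <=
     (- \sum_(j < p | (s - q <= j)%N) ln (c j))%:E)%E.
  move=> [zt z01].
  have Msym : (Mz Phi z)^T = Mz Phi z.
    by rewrite Mz_diag !trmx_mul trmxK tr_diag_mx mulmxA.
  have Mge0 (v : 'cV[R]_p) : 0 <= (v^T *m Mz Phi z *m v) 0 0.
    rewrite /Mz mulmx_sumr mulmx_suml summxE sumr_ge0// => i _.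
    rewrite -scalemxAr -scalemxAl mxE mulr_ge0 ?gram_quadratic_ge0//.
    by case/andP: (z01 i).
  have [lamS szlam chM] := eigvals_sym Msym.
  have chM' : char_poly (Mz Phi z) =
      \prod_(i < p) ('X - ((eigvals (Mz Phi z))`_i)%:P).
    by rewrite chM (big_nth 0) szlam big_mkord.
  have [S [S0 Srow Scol trE]] := mxtrace_mul_spectral Msym Ysym chM' chY.
  have := phi_le_coupling lamS _ szlam t0 tp S0 Srow Scol c_gt0 cD.
  rewrite ptE; apply; first by move=> a; exact: eigvals_ge0.
  (* Both factors [Phi] and [Phi^T] of [Mz Phi z] cancel against those of [Y], leaving the trace of
     Diag(z), which is t. *)
  rewrite -trE Mz_diag YE mulmxA mulmxK// mxtrace_mulC mulmxA mulVmx// mul1mx.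
  by rewrite mxtrace_diag -zt; apply: eq_bigr => i _; rewrite mxE.
rewrite -leeBrDl//.
apply: ge_ereal_sup => _ [z /Gamma_le zle <-]; apply: le_trans zle _.
have detK_gt0 : 0 < \det (1%:M + K) by rewrite det1K prodr_gt0.
rewrite -EFinB lee_fin lnM ?posrE//; last exact: posdefmx_det_gt0.
have -> : ln (\det (1%:M + K)) = \sum_(j < p) ln (c j).
  rewrite det1K; apply: (big_morph_in Num.pos).
  - exact: rpredM.
  - exact: rpred1.
  - exact: lnM.
  - exact: ln1.
  - by move=> j _; rewrite posrE.
(* The indices from s - q on cancel the bound on [Gamma]; the first s - q, carrying the largest
   eigenvalues, form the spectral bound. *)
have -> : \sum_(j < p) ln (c j) = \sum_(j < p | (s - q <= j)%N) ln (c j) +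
    \sum_(j < s - q) ln (1 + (eigvals K)`_j).
  rewrite (bigID (fun j : 'I_p => (s - q <= j)%N)) /=; congr (_ + _).
  under eq_bigl do rewrite -ltnNge.
  by rewrite (big_ord_narrow (ltnW s_lt)).
lra.
Qed.
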